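(* Let $G$ be a connected finite simple graph of order $n$ and size $m$ with exactly $t$ pendant vertices, where $1\leq t\leq n-1$, and let $k\geq 2$ be an integer. Then $$\gamma_{st}(G^{\frac{1}{k}})\leq\begin{cases} n & \text{if } k=2,3,\\ n+t\left\lceil \frac{k-4}{3}\right\rceil+(m-t)\left\lceil \frac{k-3}{3}\right\rceil & \text{otherwise.}\end{cases}$$
   Context: For a finite simple graph $G$, a set $D\subseteq V(G)$ is a strong dominating set of $G$ if for every vertex $x\in V(G)\setminus D$ there is a vertex $y\in D$ with $xy\in E(G)$ and $\deg(x)\leq\deg(y)$ (degrees taken in $G$). The strong domination number $\gamma_{st}(G)$ is the minimum cardinality of a strong dominating set of $G$. The order and size of $G$ are its numbers of vertices and edges; a pendant vertex is a vertex of degree $1$. The $k$-subdivision $G^{\frac{1}{k}}$ of $G$ is obtained by replacing each edge $v_iv_j$ of $G$ with a path of length $k$ between $v_i$ and $v_j$ (with $k-1$ new internal vertices, distinct for different edges); thus it has $n+(k-1)m$ vertices and $km$ edges. *)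

(* Defs.v *)
From mathcomp Require Import all_boot.

Set Implicit Arguments.
Unset Strict Implicit.
Unset Printing Implicit Defensive.

Record sgraph := SGraph {
  vertex :> finType;
  adj : rel vertex;
  adj_sym : symmetric adj;
  adj_irr : irreflexive adj
}.

Section Graph.
Variable G : sgraph.
Implicit Types (x y : G) (D : {set G}).

Definition edges : {set {set G}} := [set [set x; y] | x in G, y in G & adj x y].

Definition gorder : nat := #|G|.
Definition gsize : nat := #|edges|.

Definition deg x : nat := #|[set y | adj x y]|.

Definition pendants : {set G} := [set x | deg x == 1].

Definition connected : Prop := forall x y, connect (@adj G) x y.

Definition strong_dominating D : bool :=
  [forall x, (x \notin D) ==>
    [exists y, [&& y \in D, adj x y & deg x <= deg y]]].

(* The whole vertex set is strong dominating, so the minimum is attained. *)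
Definition gamma_st : nat :=
  #|[arg min_(D < [set: G] | strong_dominating D) #|D|]|.

Lemma strong_dominatingT : strong_dominating [set: G].
Proof. by apply/forallP=> x; rewrite inE. Qed.

(* Each edge is listed exactly once, oriented by the enumeration of the
   vertices; see card_arc.  The orientation only serves to number the internal
   vertices of the path that subdivides the edge. *)
Definition arc_pred : pred (G * G) :=
  fun p => adj p.1 p.2 && (enum_rank p.1 < enum_rank p.2).
Definition arc : finType := {p : G * G | arc_pred p}.

Lemma card_arc : #|arc| = gsize.
Proof.
pose f (p : arc) := [set (val p).1; (val p).2].
have f_inj : injective f.
  move=> [[x y] /= hp] [[x' y'] /= hq] /setP E; apply/val_inj => /=.
  move: (hp) (hq) => /andP[/= _ lt_xy] /andP[/= _ lt_xy'].
  have := E x; rewrite !inE eqxx /= => /esym/orP[]/eqP Ex.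
    have := E y; rewrite !inE eqxx orbT /= => /esym/orP[]/eqP Ey.
      by move: lt_xy; rewrite Ex Ey ltnn.
    by rewrite Ex Ey.
  have := E y; rewrite !inE eqxx orbT /= => /esym/orP[]/eqP Ey.
    by move: lt_xy; rewrite Ex Ey ltnNge (ltnW lt_xy').
  by move: lt_xy; rewrite Ex Ey ltnn.
rewrite /gsize -(card_imset _ f_inj); apply: eq_card => A.
apply/imsetP/imset2P => [[[[x y] hp] _ ->]|[x y _ /=]].
  have /andP[/= hxy _] := hp.
  by exists x y; rewrite // inE.
rewrite !inE /= => hxy ->.
have nxy : x != y by apply: contraTneq hxy => ->; rewrite adj_irr.
have [lt_xy|lt_yx|E] := ltngtP (enum_rank x) (enum_rank y).
- have hp : arc_pred (x, y) by rewrite /arc_pred /= hxy.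
  by exists (Sub (x, y) hp : arc).
- have hp : arc_pred (y, x) by rewrite /arc_pred /= adj_sym hxy.
  by exists (Sub (y, x) hp : arc); rewrite // /f /= setUC.
- by move/val_inj/enum_rank_inj: E nxy => ->; rewrite eqxx.
Qed.

Section Subdivision.
Variable k : nat.

Definition sub_vertex : finType := (G + arc * 'I_k.-1)%type.

(* Position j (0 <= j <= k) on the path of length k replacing the arc p. *)
Definition sub_pos (p : arc) (j : nat) : sub_vertex :=
  if j == 0 then inl (val p).1
  else if insub j.-1 is Some i then inr (p, i) else inl (val p).2.

Definition sub_adj : rel sub_vertex := fun a b =>
  [exists p : arc, [exists j : 'I_k,
     ((a == sub_pos p j) && (b == sub_pos p j.+1))
  || ((b == sub_pos p j) && (a == sub_pos p j.+1))]].

Lemma sub_adj_sym : symmetric sub_adj.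
Proof.
by move=> a b; apply: eq_existsb => p; apply: eq_existsb => j; rewrite orbC.
Qed.

Lemma sub_pos_inj (p : arc) : {in [pred j | j <= k] &, injective (sub_pos p)}.
Proof.
have ne12 : (val p).1 <> (val p).2.
  by move=> E; case/andP: (valP p); rewrite E adj_irr.
move=> i j; rewrite !inE /sub_pos => ik jk.
case: i ik => [|i] ik; case: j jk => [|j] jk //=.
- by case: insubP => // _ [].
- by case: insubP => // _ [/esym].
case: insubP => [u ui uE|ui]; case: insubP => [v vj vE|vj] // E.
  by case: E => E; rewrite -uE -vE E.
move: ik jk ui vj; rewrite -!leqNgt; case: (k) => //= k'; rewrite !ltnS.
by move=> ik jk ki kj; congr _.+1; apply/eqP; rewrite eqn_leq
  (leq_trans ik kj) (leq_trans jk ki).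
Qed.

Lemma sub_adj_irr : irreflexive sub_adj.
Proof.
move=> a; apply/existsP => -[p /existsP[j]]; rewrite orbb.
case/andP=> /eqP -> /eqP /sub_pos_inj; rewrite !inE ltn_ord ltnW ?ltn_ord //.
by move=> /(_ isT isT) /n_Sn.
Qed.

Definition subdivision : sgraph := SGraph sub_adj_sym sub_adj_irr.

End Subdivision.

End Graph.

Lemma order_subdivision (G : sgraph) (k : nat) :
  gorder (subdivision G k) = gorder G + k.-1 * gsize G.
Proof. by rewrite /gorder card_sum card_prod card_ord card_arc mulnC. Qed.

(* Main.v *)
Require Import Defs.
From mathcomp Require Import all_boot all_order all_algebra.
From mathcomp Require Import zify.

Set Implicit Arguments.
Unset Strict Implicit.
Unset Printing Implicit Defensive.

(** The bound comes from an explicit strong dominating set of the subdivision,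
    [domset].  Subdividing keeps the degrees of the original (branch) vertices
    and gives degree 2 to the new ones ([deg_branch], [deg_internal]).  Hence an
    internal vertex is strongly dominated by any neighbour that is internal or
    a non-pendant branch vertex, and a pendant vertex by its internal neighbour.

    The set contains every non-pendant branch vertex.  On the path of an edge
    with two non-pendant ends, these ends take care of the positions next to
    them, and the internal vertices at the positions divisible by 3 dominate
    the rest; there are [(k - 1) %/ 3] of them.  On the path of an edge with a
    pendant end, that end is left out and its neighbour is taken instead: the
    internal vertices whose distance to the pendant end is 1 modulo 3 are
    chosen, [(k - 2) %/ 3 + 1] of them, so that the vertex saved at the end pays
    for the extra one.  [domset_next] checks that this dominates.  It needs the
    two ends of an edge not to be both pendant, which holds because two adjacent
    pendant vertices of a connected graph are its only vertices
    ([adj_pendantsF]).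

    As each pendant vertex belongs to one edge, at most [t] edges are pendant
    ([card_pendant_arcs]), and the cardinality of [domset] is at most
    [(n - t) + t * ((k - 2) %/ 3 + 1) + (m - t) * ((k - 1) %/ 3)].  For [k >= 4]
    the two quotients are the ceilings of [(k - 4) / 3] and [(k - 3) / 3]
    ([ceil_div3]), and for [k = 2, 3] they vanish. *)

(** * Arcs and pendant vertices *)

Section Arcs.
Variable G : sgraph.
Implicit Types (u v w : G) (p q : Defs.arc G).

Lemma arc_adj p : adj (val p).1 (val p).2.
Proof. by case/andP: (valP p). Qed.

Lemma adj_arc v w : adj v w -> exists p, val p = (v, w) \/ val p = (w, v).
Proof.
move=> vw; have nvw : v != w by apply: contraTneq vw => ->; rewrite adj_irr.
have [lt|lt|/val_inj/enum_rank_inj E] := ltngtP (enum_rank v) (enum_rank w).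
- have h : arc_pred (v, w) by rewrite /arc_pred /= vw.
  by exists (Sub (v, w) h); left.
- have h : arc_pred (w, v) by rewrite /arc_pred /= adj_sym vw.
  by exists (Sub (w, v) h); right.
- by rewrite E eqxx in nvw.
Qed.

Lemma arc_inj p q :
  (val p).1 = (val q).1 -> (val p).2 = (val q).2 -> p = q.
Proof.
move=> E1 E2; apply/val_inj.
by rewrite [val p]surjective_pairing [val q]surjective_pairing E1 E2.
Qed.

(** Arcs are oriented increasingly, so no edge is listed in both directions. *)
Lemma arc_swapF p q : (val p).1 = (val q).2 -> (val p).2 = (val q).1 -> False.
Proof.
move=> E1 E2; case/andP: (valP p) => _; case/andP: (valP q) => _.
by rewrite E1 E2 => /ltnW; rewrite leqNgt => /negP.
Qed.

Lemma mem_pendants v : (v \in pendants G) = (deg v == 1).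
Proof. by rewrite inE. Qed.

Lemma pendant_nbr_eq v u w :
  v \in pendants G -> adj v u -> adj v w -> u = w.
Proof.
rewrite mem_pendants => /cards1P[x Ex] vu vw.
have : u \in [set y | adj v y] by rewrite inE.
have : w \in [set y | adj v y] by rewrite inE.
by rewrite Ex !inE => /eqP-> /eqP->.
Qed.

(** Two adjacent pendant vertices have no further neighbours, so they would
    form a whole component, hence the whole graph. *)
Lemma adj_pendantsF u v :
  connected G -> #|pendants G| < #|G| ->
  adj u v -> u \in pendants G -> v \notin pendants G.
Proof.
move=> conn lt_tn uv pu; apply/negP => pv.
have clo : closed (@adj G) [set u; v].
  apply: intro_closed => [|x y xy].
    by apply: sym_connect_sym; apply: adj_sym.
  rewrite !inE => /orP[]/eqP Ex; move: xy; rewrite Ex => xy.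
    by rewrite -(pendant_nbr_eq pu uv xy) eqxx orbT.
  rewrite adj_sym in uv.
  by rewrite -(pendant_nbr_eq pv uv xy) eqxx.
suff : pendants G = [set: G] by move: lt_tn => /[swap] ->; rewrite cardsT ltnn.
apply/setP => x; rewrite in_setT.
have := closed_connect clo (conn u x); rewrite !inE eqxx /= => /esym.
by case/orP=> /eqP ->; rewrite -mem_pendants.
Qed.

Definition pendant_arc p :=
  ((val p).1 \in pendants G) || ((val p).2 \in pendants G).

(** A pendant vertex is an end of only one edge, so choosing a pendant end of
    each pendant edge is injective. *)
Lemma card_pendant_arcs : #|[set p | pendant_arc p]| <= #|pendants G|.
Proof.
pose f p := if (val p).1 \in pendants G then (val p).1 else (val p).2.
have f_inj : {in [set p | pendant_arc p] &, injective f}.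
  move=> p q; rewrite !inE /f /pendant_arc => pp pq.
  have ap := arc_adj p; have aq := arc_adj q.
  have ap' := ap; rewrite adj_sym in ap'.
  have aq' := aq; rewrite adj_sym in aq'.
  case: ifP pp => /= p1 p2; case: ifP pq => /= q1 q2 E.
  - rewrite -E in aq; exact: arc_inj E (pendant_nbr_eq p1 ap aq).
  - rewrite -E in aq'; by case: (arc_swapF E (pendant_nbr_eq p1 ap aq')).
  - rewrite -E in aq; by case: (arc_swapF (pendant_nbr_eq p2 ap' aq) E).
  - rewrite -E in aq'; exact: arc_inj (pendant_nbr_eq p2 ap' aq') E.
rewrite -(card_in_imset f_inj); apply/subset_leq_card/subsetP => x.
case/imsetP=> p; rewrite inE /f /pendant_arc => + ->.
by case: ifP => [-> //|_ /=].
Qed.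

End Arcs.

(** * Degrees in the subdivision *)

Section Subdivision.
Variables (G : sgraph) (k : nat).
Hypothesis k_gt1 : 1 < k.
Implicit Types (v w : G) (p q : Defs.arc G) (i : 'I_k.-1).

Notation S := (subdivision G k).

Lemma sub_pos0 p : sub_pos k p 0 = inl (val p).1.
Proof. by []. Qed.

Lemma sub_posk p : sub_pos k p k = inl (val p).2.
Proof.
rewrite /sub_pos; case: eqP => [k0|_]; first by move: k_gt1; rewrite {1}k0.
by case: insubP => // i; rewrite ltnn.
Qed.

Lemma sub_posS p i : sub_pos k p i.+1 = inr (p, i).
Proof. by rewrite /sub_pos /= valK. Qed.

Lemma sub_pos_inr p q i j : sub_pos k q j = inr (p, i) -> q = p /\ j = i.+1.
Proof.
rewrite /sub_pos; case: j => [|j] //=; case: insubP => // i' _ E [-> <-].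
by rewrite E.
Qed.

Lemma sub_pos_inl v q j : j <= k -> sub_pos k q j = inl v ->
  (j = 0 /\ (val q).1 = v) \/ (j = k /\ (val q).2 = v).
Proof.
rewrite /sub_pos; case: j => [|j] /= jk; first by case=> ->; left.
by case: insubP => // nj [->]; right; split=> //; lia.
Qed.

Lemma adj_sub_pos p j : j < k -> adj (sub_pos k p j : S) (sub_pos k p j.+1).
Proof.
move=> jk; apply/existsP; exists p; apply/existsP; exists (Ordinal jk).
by rewrite !eqxx.
Qed.

Lemma sub_adjP (a b : S) : reflect
  (exists p, exists2 j, j < k &
     (a = sub_pos k p j /\ b = sub_pos k p j.+1)
  \/ (b = sub_pos k p j /\ a = sub_pos k p j.+1)) (adj a b).
Proof.
apply: (iffP existsP) => [[p /existsP[j h]]|[p [j jk h]]]; exists p.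
  exists j; first exact: ltn_ord.
  by case/orP: h => /andP[/eqP-> /eqP->]; [left|right].
apply/existsP; exists (Ordinal jk) => /=.
by case: h => [] [-> ->]; rewrite !eqxx ?orbT.
Qed.

Lemma deg_internal p i : deg (inr (p, i) : S) = 2.
Proof.
have ik : i.+1 < k by have := ltn_ord i; lia.
have -> : 2 = #|[set (sub_pos k p i : S); sub_pos k p i.+2]|.
  rewrite cards2; case: eqP => // /sub_pos_inj; rewrite !inE.
  by move=> /(_ (ltnW (ltnW ik)) ik); lia.
apply: eq_card => b; rewrite [LHS]inE !inE.
apply/idP/idP => [/sub_adjP[q [j jk]] [] [] E1 E2|].
- by have [Eq Ej] := sub_pos_inr (esym E1); rewrite E2 Eq Ej eqxx orbT.
- by have [Eq [Ej]] := sub_pos_inr (esym E2); rewrite E1 Eq Ej eqxx.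
rewrite -sub_posS; case/orP=> /eqP->; last exact: adj_sub_pos.
by rewrite adj_sym; apply: adj_sub_pos; apply: ltnW.
Qed.

Lemma adj_branchP v (a : S) : reflect
  (exists q, ((val q).1 = v /\ a = sub_pos k q 1)
          \/ ((val q).2 = v /\ a = sub_pos k q k.-1)) (adj (inl v : S) a).
Proof.
have k1 : k.-1.+1 = k by lia.
apply: (iffP idP) => [/sub_adjP[q [j jk] h]|[q [] [<- ->]]].
- exists q; case: h => [] [E1 E2].
    have [[j0 <-]|[]] := sub_pos_inl (ltnW jk) (esym E1); last by lia.
    by left; rewrite E2 j0.
  have [[]|[jk' <-]] := sub_pos_inl jk (esym E2) => //.
  by right; rewrite E1 -jk'.
- by rewrite -sub_pos0; apply: adj_sub_pos; apply: ltnW.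
- by rewrite adj_sym -sub_posk; have := @adj_sub_pos q k.-1; rewrite k1; apply.
Qed.

(** The neighbours of a branch vertex [v] correspond to the edges at [v]; each
    is mapped to the other end of its edge. *)
Lemma deg_branch v : deg (inl v : S) = deg v.
Proof.
(* The value on branch vertices is arbitrary: since [1 < k], two branch vertices
   are never adjacent. *)
pose g (a : S) : G := match a with
  | inl u => u
  | inr (q, _) => if (val q).1 == v then (val q).2 else (val q).1
  end.
have gpos q j : 0 < j < k ->
    g (sub_pos k q j) = if (val q).1 == v then (val q).2 else (val q).1.
  case: j => // j jk; have jk' : j < k.-1 by lia.
  by rewrite (sub_posS q (Ordinal jk')).
have g1 q : (val q).1 = v -> g (sub_pos k q 1) = (val q).2.
  by move=> E; rewrite gpos ?E ?eqxx //; lia.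
have g2 q : (val q).2 = v -> g (sub_pos k q k.-1) = (val q).1.
  move=> E; rewrite gpos; last by lia.
  case: eqP => // E1; have := arc_adj q.
  by rewrite E E1 adj_irr.
have g_inj : {in [set a | adj (inl v : S) a] &, injective g}.
  move=> a b; rewrite !inE.
  case/adj_branchP=> q [] [qv ->] /adj_branchP[q' [] [q'v ->]];
    rewrite ?(g1 _ qv) ?(g1 _ q'v) ?(g2 _ qv) ?(g2 _ q'v) => E.
  - by rewrite (@arc_inj _ q q') // qv q'v.
  - by case: (@arc_swapF _ q q'); rewrite ?qv ?q'v.
  - by case: (@arc_swapF _ q q'); rewrite ?qv ?q'v.
  - by rewrite (@arc_inj _ q q') // qv q'v.
rewrite /deg -(card_in_imset g_inj); apply: eq_card => w; rewrite inE.
apply/imsetP/idP => [[a]|vw].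
  rewrite inE => /adj_branchP[q [] [qv ->] ->].
    by rewrite g1 // -qv arc_adj.
  by rewrite g2 // -qv adj_sym arc_adj.
have [q [] E] := adj_arc vw.
  exists (sub_pos k q 1); last by rewrite g1 E.
  by rewrite inE; apply/adj_branchP; exists q; left; rewrite E.
exists (sub_pos k q k.-1); last by rewrite g2 E.
by rewrite inE; apply/adj_branchP; exists q; right; rewrite E.
Qed.

(** * The dominating set *)

(** [i : 'I_k.-1] numbers the internal vertex at position [i.+1], so [i] is its
    distance to the first end minus 1, and [rev_ord i] its distance to the
    second end minus 1. *)
Definition marked p i : bool :=
  if (val p).1 \in pendants G then i %% 3 == 0
  else if (val p).2 \in pendants G then rev_ord i %% 3 == 0
  else i.+1 %% 3 == 0.

Definition domset : {set S} :=
  [set a : S | match a with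
           | inl v => v \notin pendants G
           | inr (p, i) => marked p i
           end].

Lemma domset_branch v : ((inl v : S) \in domset) = (v \notin pendants G).
Proof. by rewrite inE. Qed.

Lemma domset_internal p j : 0 < j < k ->
  ((sub_pos k p j : S) \in domset) =
  (if (val p).1 \in pendants G then j %% 3 == 1
   else if (val p).2 \in pendants G then (k - j) %% 3 == 1
   else j %% 3 == 0).
Proof.
case: j => // j jk; have jk' : j < k.-1 by lia.
rewrite (sub_posS p (Ordinal jk')) inE /marked /=.
by do 2?case: ifP => _ //; lia.
Qed.

Section Domination.
Hypothesis conn : connected G.
Hypothesis lt_tn : #|pendants G| < #|G|.

Lemma pendant_arcF p : (val p).1 \in pendants G -> (val p).2 \notin pendants G.
Proof. by apply: adj_pendantsF => //; apply: arc_adj. Qed.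

(** Every vertex of a subdivided edge missing from [domset] has a neighbour in
    it along the path, because the chosen positions, together with the
    non-pendant ends, leave gaps of at most two, and of at most one at a
    pendant end. *)
Lemma domset_next p j : j <= k -> (sub_pos k p j : S) \notin domset ->
  (j < k /\ (sub_pos k p j.+1 : S) \in domset)
  \/ (0 < j /\ (sub_pos k p j.-1 : S) \in domset).
Proof.
move=> jk.
have npp := @pendant_arcF p.
have h0 := domset_branch (val p).1; rewrite -sub_pos0 in h0.
have hk := domset_branch (val p).2; rewrite -sub_posk in hk.
have hi := @domset_internal p.
have [j0|[jk'|ji]] : j = 0 \/ (j = k \/ 0 < j < k) by lia.
- rewrite j0 h0 negbK => p1; left; split; first by lia.
  by rewrite hi ?p1 //; lia.
- rewrite jk' hk negbK => p2; right; split; first by lia.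
  rewrite hi; last by lia.
  by case: ifP => [/npp|_]; rewrite p2 //; lia.
have hp : j.-1 = 0 \/ 0 < j.-1 < k by lia.
have hn : j.+1 = k \/ 0 < j.+1 < k by lia.
have := hi _ ji; case: ifP => p1; [|case: ifP => p2] => ->.
(* Pendant start: [j] modulo 3 is 0 or 2, and 1 is to be reached.  The end [k],
   whatever its residue, belongs to [domset]. *)
- move=> j1.
  case E : (j %% 3 == 0); [left|right]; (split; first by lia).
    by case: hn => [->|/hi->]; [rewrite hk npp|rewrite p1; lia].
  case: hp => [|/hi->]; first by lia.
  by rewrite p1; lia.
(* Pendant end: the mirror image of the previous case. *)
- move=> j1.
  case E : ((k - j) %% 3 == 0); [right|left]; (split; first by lia).
    by case: hp => [->|/hi->]; [rewrite h0 p1|rewrite p1 p2; lia].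
  case: hn => [|/hi->]; first by lia.
  by rewrite p1 p2; lia.
- move=> j1.
  case E : (j %% 3 == 1); [right|left]; (split; first by lia).
    by case: hp => [->|/hi->]; [rewrite h0 p1|rewrite p1 p2; lia].
  by case: hn => [->|/hi->]; [rewrite hk p2|rewrite p1 p2; lia].
Qed.

Lemma deg_notin_domset (a : S) : a \notin domset -> deg a <= 2.
Proof.
case: a => [v|[p i]]; last by rewrite deg_internal.
by rewrite domset_branch negbK mem_pendants deg_branch => /eqP->.
Qed.

(** A branch vertex of [domset] that has a neighbour has degree neither 0 nor 1.
    Isolated vertices do belong to [domset], hence the neighbour [a]. *)
Lemma deg_in_domset (a b : S) : b \in domset -> adj a b -> 2 <= deg b.
Proof.
case: b => [v|[p i]]; last by rewrite deg_internal.
rewrite domset_branch mem_pendants -deg_branch => v1 av.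
have : 0 < deg (inl v : S) by apply/card_gt0P; exists a; rewrite inE adj_sym.
by lia.
Qed.

(** The branch vertices left out are pendant, so they are ends of arcs. *)
Lemma notin_domset_pos (a : S) : a \notin domset ->
  exists p, exists2 j, j <= k & a = sub_pos k p j.
Proof.
case: a => [v|[p i]] => [|_]; last first.
  by exists p, i.+1; [have := ltn_ord i; lia|rewrite sub_posS].
rewrite domset_branch negbK mem_pendants => /eqP v1.
have /card_gt0P[w] : 0 < #|[set y | adj v y]| by rewrite -[#|_|]/(deg v) v1.
rewrite inE => /adj_arc[p [] E]; exists p.
  by exists 0; rewrite // sub_pos0 E.
by exists k; rewrite // sub_posk E.
Qed.

Lemma domset_strong_dominating : strong_dominating domset.
Proof.
apply/forallP => a; apply/implyP => aD.
suff [b bD ab] : exists2 b : S, b \in domset & adj a b.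
  apply/existsP; exists b; rewrite bD ab /=.
  exact: leq_trans (deg_notin_domset aD) (deg_in_domset bD ab).
have [p [j jk Ea]] := notin_domset_pos aD; rewrite Ea in aD *.
have [[jk' D]|[j0 D]] := domset_next jk aD.
  by exists (sub_pos k p j.+1); rewrite ?adj_sub_pos.
exists (sub_pos k p j.-1) => //; rewrite adj_sym -{2}(prednK j0).
by apply: adj_sub_pos; lia.
Qed.

End Domination.

(** * Counting *)

Lemma count_mod3 (n : nat) : \sum_(i < n) (i %% 3 == 0) = (n + 2) %/ 3.
Proof. by elim: n => [|n IH]; rewrite ?big_ord0 // big_ord_recr /= IH; lia. Qed.

Lemma count_mod3S (n : nat) : \sum_(i < n) (i.+1 %% 3 == 0) = n %/ 3.
Proof. by elim: n => [|n IH]; rewrite ?big_ord0 // big_ord_recr /= IH; lia. Qed.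

Lemma sum_marked p :
  \sum_i marked p i = if pendant_arc p then ((k - 2) %/ 3).+1 else (k - 1) %/ 3.
Proof.
rewrite /marked /pendant_arc.
case: ((val p).1 \in pendants G) => /=; last case: ((val p).2 \in pendants G).
- by rewrite count_mod3; lia.
- rewrite (reindex_inj rev_ord_inj).
  under eq_bigr => i _ do rewrite -[_ - _]/(val (rev_ord (rev_ord i))) rev_ordK.
  by rewrite count_mod3; lia.
- by rewrite count_mod3S subn1.
Qed.

Lemma card_domset :
  #|domset| = #|G| - #|pendants G| +
    (#|[set p | @pendant_arc G p]| * ((k - 2) %/ 3).+1 +
     (gsize G - #|[set p | @pendant_arc G p]|) * ((k - 1) %/ 3)).
Proof.
have cardD (T : finType) (A : {set T}) : #|T| - #|A| = #|~: A|.
  by rewrite -(cardsC A) addKn.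
have card_sum (T : finType) (A : {pred T}) : #|A| = \sum_x (x \in A).
  by rewrite -sum1_card big_mkcond; apply: eq_bigr => x _; case: ifP.
rewrite card_sum big_sumType /=; congr (_ + _).
  rewrite cardD card_sum; apply: eq_bigr => v _.
  by rewrite domset_branch in_setC.
transitivity (\sum_p \sum_i marked p i).
  rewrite (pair_bigA _ (fun p i => nat_of_bool (marked p i))) /=.
  by apply: eq_bigr => -[p i] _; rewrite inE.
under eq_bigr do rewrite sum_marked.
rewrite (bigID (@pendant_arc G)) /= -card_arc cardD; congr (_ + _).
  rewrite -sum_nat_const; apply: eq_big => [p|p ->] //; by rewrite inE.
by rewrite -sum_nat_const; apply: eq_big => [p|p /negbTE->] //; rewrite !inE.
Qed.

End Subdivision.

(** * The upper bound *)

Lemma gamma_st_le (G : sgraph) (D : {set G}) :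
  strong_dominating D -> gamma_st G <= #|D|.
Proof.
move=> sD; rewrite /gamma_st.
by case: arg_minnP => [|E _ /(_ D sD)//]; apply: strong_dominatingT.
Qed.

Import Order.TTheory GRing.Theory Num.Theory.

Lemma ceil_div3 (a : nat) : (Num.ceil (a%:Q / 3) = ((a + 2) %/ 3)%N%:Z)%R.
Proof.
apply: ceil_def; rewrite ltr_pdivlMr // ler_pdivrMr //.
rewrite -[3%R]/(3%:Z%:~R : rat)%R -!intrM ltr_int ler_int.
by lia.
Qed.

Theorem theorem3p4 (G : sgraph) (n m t k : nat) :
  connected G ->
  gorder G = n ->
  gsize G = m ->
  #|pendants G| = t ->
  (1 <= t <= n - 1)%N ->
  (2 <= k)%N ->
  ((gamma_st (subdivision G k))%:Z <=
    if (k == 2)%N || (k == 3)%N then n%:Z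
    else n%:Z + t%:Z * Num.ceil ((k%:Q - 4) / 3)
         + (m%:Z - t%:Z) * Num.ceil ((k%:Q - 3) / 3))%R.
Proof.
move=> conn En Em Et /andP[t_gt0 t_lt] k_gt1; rewrite /gorder in En.
have lt_tn : #|pendants G| < #|G| by lia.
have := gamma_st_le (domset_strong_dominating k_gt1 conn lt_tn).
rewrite card_domset // En Em Et.
have := card_pendant_arcs G; rewrite Et.
have : #|[set p | @pendant_arc G p]| <= m by rewrite -Em -card_arc max_card.
move: #|_| (gamma_st _) => s g le_sm le_st le_g.
case: ifP => k23.
  have k1 : (k - 1) %/ 3 = 0 by lia.
  have k2 : (k - 2) %/ 3 = 0 by lia.
  by rewrite k1 k2 in le_g; lia.
have -> : (k%:Q - 4 = (k - 4)%N%:Q)%R by rewrite -subzn ?intrB //; lia.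
have -> : (k%:Q - 3 = (k - 3)%N%:Q)%R by rewrite -subzn ?intrB //; lia.
rewrite !ceil_div3.
have -> : (k - 4 + 2) %/ 3 = (k - 2) %/ 3 by congr (_ %/ _); lia.
have -> : (k - 3 + 2) %/ 3 = (k - 1) %/ 3 by congr (_ %/ _); lia.
(* A pendant edge contributes at least as many vertices as another one, so the
   bound [s <= t] on the number [s] of pendant edges suffices. *)
have : (k - 1) %/ 3 <= ((k - 2) %/ 3).+1 by lia.
move: ((k - 1) %/ 3) ((k - 2) %/ 3) le_g => c d le_g le_cd.
nia.
Qed.
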